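(* Let $\mathbb K\subset\mathcal D_+$ be a compact set. Then there exists a constant $c_{\mathbb K}>0$ such that for all $X\in\mathcal H$ and all $\rho\in\mathbb K$, $$Q_\rho\bigl(\nabla_L(X-\mathrm{proj}(X))\bigr)\ \ge\ c_{\mathbb K}\,\|X-\mathrm{proj}(X)\|^2 .$$
   Context: Fix integers $n,N\ge 1$ and Hermitian matrices $L_1,\dots,L_N\in\mathbb C^{n\times n}$. $\mathcal H$ and $\mathcal S$ denote the real vector spaces of $n\times n$ complex Hermitian, respectively skew-Hermitian, matrices. $\mathcal H_{++}$ is the set of positive definite matrices in $\mathcal H$ and $\mathcal D_+=\{\rho\in\mathcal H_{++}:\mathrm{tr}(\rho)=1\}$. $\mathcal S^N$ is the space of block columns $v=[v_1^*,\dots,v_N^*]^*\in\mathbb C^{nN\times n}$ with $v_k\in\mathcal S$. On $\mathcal H$ use the inner product $\langle X;Y\rangle=\mathrm{tr}(X^*Y)$ and the associated norm $\|\cdot\|$. The gradient operator $\nabla_L:\mathcal H\to\mathcal S^N$ sends $X$ to the block column with $k$-th block $L_kX-XL_k$. $\mathrm{proj}$ is the orthogonal projection of $\mathcal H$ onto $\ker(\nabla_L)$. For $v\in\mathbb C^{nN\times n}$ and $\rho$ positive semidefinite, $Q_\rho(v)=\mathrm{tr}(\rho v^*v)$. *)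

(* Defs.v *)
From HB Require Import structures.
From mathcomp Require Import all_boot all_order all_algebra.
From mathcomp Require Import complex.
From mathcomp Require Import all_classical all_reals all_analysis.

Set Implicit Arguments.
Unset Strict Implicit.
Unset Printing Implicit Defensive.

Import Order.TTheory GRing.Theory Num.Theory.
Import numFieldNormedType.Exports.

Local Open Scope classical_set_scope.
Local Open Scope ring_scope.
Local Open Scope sesquilinear_scope.

Section Defs.
Variables (C : numClosedFieldType) (n : nat).
Implicit Types (X Y P rho : 'M[C]_n).

Definition herm : set 'M[C]_n := [set X | X \is hermsymmx].

Definition skew_herm : set 'M[C]_n := [set X | X \is hermitianmx n true Num.conj].

(* In the order of [C], [0 < z] means that z is real and positive. *)
Definition herm_posdef : set 'M[C]_n :=
  [set X | herm X /\
     forall u : 'cV[C]_n, u != 0 -> 0 < (u ^t* *m X *m u) 0 0].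

Definition dens_pos : set 'M[C]_n := [set rho | herm_posdef rho /\ \tr rho = 1].

Definition hs_dot X Y : C := \tr (X ^t* *m Y).

Definition hs_norm X : C := sqrtC (hs_dot X X).

Definition quad_form m rho (v : 'M[C]_(m, n)) : C := \tr (rho *m v ^t* *m v).

Variables (N : nat) (L : 'I_N -> 'M[C]_n).

Definition skew_cols : set 'M[C]_(\sum_(k < N) n, n) :=
  [set v | forall k : 'I_N, skew_herm (submxcol v k)].

Definition grad X : 'M[C]_(\sum_(k < N) n, n) :=
  \mxcol_(k < N) (L k *m X - X *m L k).

(* [grad] is defined on all matrices; its kernel is taken in [herm]. *)
Definition ker_grad : set 'M[C]_n := [set X | herm X /\ grad X = 0].

Definition is_proj_ker X P : Prop :=
  ker_grad P /\ forall Y, ker_grad Y -> hs_dot (X - P) Y = 0.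

(* For X in [herm] this P exists and is unique: see [proj_kerP] and
   [is_proj_ker_uniq]. *)
Definition proj_ker X : 'M[C]_n := get (is_proj_ker X).

End Defs.

Section Facts.
Variables (C : numClosedFieldType) (n N : nat) (L : 'I_N -> 'M[C]_n).
Implicit Types (X Y P : 'M[C]_n).

Lemma hermP X : herm X <-> X ^t* = X.
Proof.
split=> [/is_hermitianmxP|e]; first by rewrite expr0 scale1r.
by apply/is_hermitianmxP; rewrite expr0 scale1r e.
Qed.

Lemma skew_hermP X : skew_herm X <-> X ^t* = - X.
Proof.
split.
  by move/is_hermitianmxP; rewrite expr1 scaleN1r => {2}->; rewrite opprK.
by move=> e; apply/is_hermitianmxP; rewrite expr1 scaleN1r e opprK.
Qed.

Lemma adjM m p q (A : 'M[C]_(m, p)) (B : 'M[C]_(p, q)) :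
  (A *m B) ^t* = B ^t* *m A ^t*.
Proof. by rewrite trmx_mul map_mxM. Qed.

Lemma adjB m p (A B : 'M[C]_(m, p)) : (A - B) ^t* = A ^t* - B ^t*.
Proof. by rewrite linearB /= map_mxB. Qed.

Lemma hs_dotE X Y : hs_dot X Y = \sum_i \sum_j (X i j)^* * Y i j.
Proof.
rewrite /hs_dot /mxtrace exchange_big /=; apply: eq_bigr => i _.
by rewrite mxE; apply: eq_bigr => j _; rewrite !mxE.
Qed.

Lemma hs_dot_eq0 X : hs_dot X X = 0 -> X = 0.
Proof.
have ge0 i j : 0 <= (X i j)^* * X i j by rewrite mulrC mul_conjC_ge0.
rewrite hs_dotE => h; apply/matrixP=> i j; rewrite mxE; apply/eqP.
have {h} := psumr_eq0P (fun i _ => sumr_ge0 _ (fun j _ => ge0 i j)) h.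
move=> /(_ i isT) /(psumr_eq0P (fun j _ => ge0 i j)) /(_ j isT) /eqP.
by rewrite mulrC mul_conjC_eq0.
Qed.

Lemma hs_dotBl X Y Z : hs_dot (X - Y) Z = hs_dot X Z - hs_dot Y Z.
Proof. by rewrite /hs_dot adjB mulmxBl raddfB. Qed.

Lemma hs_dot_adj X Y : hs_dot (X ^t*) (Y ^t*) = (hs_dot X Y)^*.
Proof.
rewrite !hs_dotE exchange_big rmorph_sum; apply: eq_bigr => i _.
rewrite rmorph_sum; apply: eq_bigr => j _.
by rewrite rmorphM !mxE.
Qed.

Fact grad_is_linear : linear (grad L).
Proof.
move=> a X Y; apply/mxcolP => k; rewrite submxcolD.
have -> : submxcol (a *: grad L X) k = a *: submxcol (grad L X) k.
  by apply/matrixP=> i j; rewrite !mxE.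
rewrite /grad !mxcolK.
rewrite mulmxDr mulmxDl -scalemxAr -scalemxAl scalerBr opprD.
by rewrite !addrA; congr (_ - _); rewrite -!addrA; congr (_ + _); rewrite addrC.
Qed.

HB.instance Definition _ :=
  GRing.isLinear.Build C 'M[C]_n 'M[C]_(\sum_(k < N) n, n) _ (grad L) grad_is_linear.

Hypothesis hL : forall k, herm (L k).

Lemma grad_skew X : herm X -> skew_cols (grad L X).
Proof.
move=> /hermP hX k; apply/skew_hermP.
rewrite /grad mxcolK adjB !adjM hX (hermP (L k)).1 //.
by rewrite opprB.
Qed.

Lemma grad_eq0 X : grad L X = 0 <-> forall k, L k *m X = X *m L k.
Proof.
split=> [h k|h].
  by have := congr1 (fun v => submxcol v k) h; rewrite mxcolK submxcol0 => /subr0_eq.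
by rewrite /grad -mxcol0; apply/eq_mxcolP => k; rewrite h subrr.
Qed.

Lemma is_proj_ker_uniq X P Q :
  is_proj_ker L X P -> is_proj_ker L X Q -> P = Q.
Proof.
move=> [[hP kP] oP] [[hQ kQ] oQ].
have kPQ : ker_grad L (P - Q).
  split; first by apply/hermP; rewrite adjB (hermP P).1 // (hermP Q).1.
  by rewrite linearB /= kP kQ subrr.
apply/subr0_eq/hs_dot_eq0.
have {1}-> : P - Q = (X - Q) - (X - P) by rewrite opprB [RHS]addrC addrA subrK.
by rewrite hs_dotBl oP // oQ // subrr.
Qed.

Lemma proj_kerP X : herm X -> is_proj_ker L X (proj_ker L X).
Proof.
move=> /hermP hX; apply: getPex.
pose K := kermx (lin_mx (grad L)).
have inK Y : grad L Y = 0 <-> (mxvec Y <= K)%MS.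
  split=> [h|/sub_kermxP]; first by apply/sub_kermxP; rewrite mul_vec_lin /= h linear0.
  by rewrite mul_vec_lin /= => /eqP; rewrite mxvec_eq0 => /eqP.
pose P : 'M[C]_n := vec_mx (mxvec X *m proj_ortho K).
have kP : grad L P = 0 by apply/inK; rewrite vec_mxK proj_ortho_sub.
have oP Y : grad L Y = 0 -> hs_dot (X - P) Y = 0.
  move=> /inK hY.
  have /orthomx1P h : (mxvec Y <=
      orthomx Num.conj (mx_of_hermitian (hermitian1mx _)) (mxvec (X - P)))%MS.
    rewrite orthomx_sym linearB /= vec_mxK.
    apply: (submx_trans (proj_ortho_compl_sub K (mxvec X))).
    by rewrite submx_ortho.
  move: h => /matrixP/(_ 0 0); rewrite !mxE => h.
  rewrite hs_dotE -[RHS]h pair_bigA /= (reindex _ (curry_mxvec_bij _ _)) /=.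
  by apply: eq_bigr => -[i j] _ /=; rewrite mxvecE mulrC [map_mx _ _ _ _]mxE
    [_^T _ _]mxE mxvecE.
have adjK Y : grad L Y = 0 -> grad L (Y ^t*) = 0.
  rewrite !grad_eq0 => h k; have := congr1 (fun Z : 'M[C]_n => Z ^t*) (h k).
  by rewrite !adjM (hermP (L k)).1.
have adjKK Y : (Y ^t*) ^t* = Y :> 'M[C]_n by rewrite trmxCK.
exists P; split; last by move=> Y [_]; apply: oP.
split=> //; apply/hermP/esym.
pose D := P - P ^t*.
have kD : grad L D = 0 by rewrite linearB /= kP adjK // subrr.
apply/subr0_eq/hs_dot_eq0.
have {1}-> : P - P ^t* = (X - P ^t*) - (X - P).
  by rewrite opprB [RHS]addrC addrA subrK.
rewrite hs_dotBl (oP _ kD) subr0 -{1}hX -adjB -[P - _]adjKK hs_dot_adj.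
by rewrite oP ?conjC0 // adjK.
Qed.
End Facts.

(* The complex field is wrapped as a [numClosedFieldType] because it is through
   that structure that MathComp-Analysis gives it, and the matrices over it,
   their norm topology; [R[i]] alone carries none. *)
Definition cplx (R : realType) : numClosedFieldType := complex R.

Definition cplx_of (R : realType) (x : R) : cplx R := real_complex R x.

Arguments cplx : simpl never.

(* Main.v *)
Require Import Defs.
From mathcomp Require Import all_boot all_order all_algebra.
From mathcomp Require Import complex.
From mathcomp Require Import all_classical all_reals all_analysis.
Import Order.TTheory GRing.Theory Num.Theory.
Import numFieldNormedType.Exports.
Local Open Scope classical_set_scope.
Local Open Scope ring_scope.
Local Open Scope sesquilinear_scope.

(** Write [Y] for [X - proj_ker L X], [v] for [grad L Y], and [|.|] for the
    Frobenius norm. The inequality is the product of two bounds.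

    Uniform positivity of [rho]. The eigenvalues of a density matrix are
    positive and sum to 1, so each lies in ]0, 1] and is therefore at least
    their product [\det rho]. Diagonalizing [rho] unitarily gives
    [\det rho * |v|^2 <= quad_form rho v] ([dens_pos_quad_form_ge]). The
    determinant is continuous and positive on the compact set [K], hence at
    least some [d > 0] there ([dens_pos_compact_det_ge]).

    Coercivity of the gradient. If a row vector [y] is orthogonal to the kernel
    of [A] and [B] is a partial inverse of [A], then [w = y A B] differs from
    [y] by an element of that kernel, so
    [|y|^2 <= |w|^2 <= \tr (B B^* ) |y A|^2] ([orth_kernel_bound]). Applied to
    the matrix of [grad L] on vectorized matrices, this yields
    [|Y|^2 <= M |v|^2] ([grad_coercive]). Here [Y] is only known to be
    orthogonal to the Hermitian part of the kernel, but as the [L k] are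
    Hermitian the kernel is stable under adjunction, and its Hermitian part
    spans it over the complex numbers ([orth_ker_grad]).

    The constant is [d / M]. *)

Set Implicit Arguments.
Unset Strict Implicit.
Unset Printing Implicit Defensive.

(** * The Frobenius inner product and quadratic forms *)

(** The inner product [tr (X^* Y)] of rectangular matrices; on square
    matrices it is [hs_dot]. *)
Definition frob {C : numClosedFieldType} {m n : nat} (X Y : 'M[C]_(m, n)) : C :=
  \tr (X ^t* *m Y).

Section Frobenius.
Variables (C : numClosedFieldType).

Lemma frobE m n (X Y : 'M[C]_(m, n)) :
  frob X Y = \sum_j \sum_i (X i j)^* * Y i j.
Proof.
by apply: eq_bigr => j _; rewrite mxE; apply: eq_bigr => i _; rewrite !mxE.
Qed.

Lemma frob_ge0 m n (X : 'M[C]_(m, n)) : 0 <= frob X X.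
Proof.
by rewrite frobE; do 2![apply: sumr_ge0 => ? _]; rewrite mulrC mul_conjC_ge0.
Qed.

Lemma frobBl m n (X Y Z : 'M[C]_(m, n)) : frob (X - Y) Z = frob X Z - frob Y Z.
Proof. by rewrite /frob adjB mulmxBl raddfB. Qed.

Lemma frobDr m n (X Y Z : 'M[C]_(m, n)) : frob X (Y + Z) = frob X Y + frob X Z.
Proof. by rewrite /frob mulmxDr raddfD. Qed.

Lemma frobBr m n (X Y Z : 'M[C]_(m, n)) : frob X (Y - Z) = frob X Y - frob X Z.
Proof. by rewrite /frob mulmxBr raddfB. Qed.

Lemma frobZr m n a (X Y : 'M[C]_(m, n)) : frob X (a *: Y) = a * frob X Y.
Proof. by rewrite /frob -scalemxAr linearZ. Qed.

Lemma frobC m n (X Y : 'M[C]_(m, n)) : frob Y X = (frob X Y)^*.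
Proof.
rewrite !frobE rmorph_sum; apply: eq_bigr => j _.
by rewrite rmorph_sum; apply: eq_bigr => i _; rewrite rmorphM /= conjCK mulrC.
Qed.

Lemma frob_mxvec m n (X Y : 'M[C]_(m, n)) : frob (mxvec X) (mxvec Y) = frob X Y.
Proof.
rewrite !frobE exchange_big big_ord1 [RHS]exchange_big pair_bigA /=.
rewrite (reindex _ (curry_mxvec_bij _ _)) /=.
by apply: eq_bigr => -[i j] _ /=; rewrite !mxvecE.
Qed.

(** No unitarity of [P] is needed here; [frob_unitary] is the case where the
    conjugated diagonal matrix is the identity. *)
Lemma quad_form_conj_diag n m (P : 'M[C]_n) (d : 'rV[C]_n) (v : 'M[C]_(m, n)) :
  quad_form (P ^t* *m diag_mx d *m P) v =
    \sum_i d 0 i * \sum_k `|(v *m P ^t*) k i| ^+ 2.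
Proof.
set w := v *m P ^t*.
have -> : quad_form (P ^t* *m diag_mx d *m P) v = \tr (diag_mx d *m (w ^t* *m w)).
  by rewrite /quad_form /w adjM trmxCK -!mulmxA mxtrace_mulC !mulmxA.
apply: eq_bigr => i _.
rewrite mul_diag_mx !mxE; congr (_ * _).
by apply: eq_bigr => k _; rewrite normCKC !mxE.
Qed.

Lemma frob_unitary n m (P : 'M[C]_n) (v : 'M[C]_(m, n)) : P \is unitarymx ->
  frob v v = \sum_i \sum_k `|(v *m P ^t*) k i| ^+ 2.
Proof.
move=> Pu; have := quad_form_conj_diag P (const_mx 1) v.
rewrite diag_const_mx mulmx1 -invmx_unitary // mulVmx ?unitarymx_unit //.
rewrite /quad_form mul1mx -/(frob v v) => ->.
by apply: eq_bigr => i _; rewrite mxE mul1r.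
Qed.

End Frobenius.

(** * Spectral bounds for quadratic forms *)

Section Spectral.
Variables (C : numClosedFieldType) (n : nat).
Implicit Types H : 'M[C]_n.

Lemma herm_spectral H : herm H ->
  H = (spectralmx H) ^t* *m diag_mx (spectral_diag H) *m spectralmx H.
Proof.
move=> /hermitian_normalmx/orthomx_spectralP.
by rewrite invmx_unitary ?spectral_unitarymx.
Qed.

(** The [i]-th eigenvalue is the value of the form at the [i]-th (nonzero)
    eigenvector, whose adjoint is a row of [spectralmx H]; the sign of the
    eigenvalues follows from that of the form. *)
Lemma herm_spectral_diagE H i : herm H ->
  let u := (row i (spectralmx H)) ^t* in
  u != 0 /\ spectral_diag H 0 i = (u ^t* *m H *m u) 0 0.
Proof.
move=> hH u; set P := spectralmx H.
have PP : P *m P ^t* = 1%:M by apply/unitarymxP/spectral_unitarymx.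
have uE : u = P ^t* *m delta_mx i 0.
  by rewrite /u rowE adjM; congr (_ *m _); apply/matrixP=> a b;
     rewrite !mxE conjC_nat andbC.
have PuE : P *m u = delta_mx i 0 by rewrite uE mulmxA PP mul1mx.
split.
  apply/eqP => u0; move: PuE; rewrite u0 mulmx0 => /matrixP/(_ i 0)/esym/eqP.
  by rewrite !mxE !eqxx oner_eq0.
rewrite [in RHS](herm_spectral hH) -/P.
have -> : u ^t* *m (P ^t* *m diag_mx (spectral_diag H) *m P) *m u =
    (P *m u) ^t* *m diag_mx (spectral_diag H) *m (P *m u).
  by rewrite adjM !mulmxA.
rewrite PuE.
have -> : (delta_mx i 0 : 'M[C]_(n, 1)) ^t* = delta_mx 0 i.
  by apply/matrixP=> a b; rewrite !mxE conjC_nat andbC.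
by rewrite -rowE -colE !mxE eqxx mulr1n.
Qed.

Lemma herm_trace_spectral H : herm H -> \tr H = \sum_i spectral_diag H 0 i.
Proof.
move=> hH; rewrite [in LHS](herm_spectral hH) mxtrace_mulC mulmxA.
rewrite (unitarymxP (spectral_unitarymx H)) mul1mx.
by apply: eq_bigr => i _; rewrite mxE eqxx mulr1n.
Qed.

Lemma herm_det_spectral H : herm H -> \det H = \prod_i spectral_diag H 0 i.
Proof.
move=> hH; rewrite [in LHS](herm_spectral hH) !det_mulmx mulrAC -det_mulmx.
rewrite -invmx_unitary ?spectral_unitarymx // mulVmx ?spectral_unit //.
by rewrite det1 mul1r det_diag.
Qed.

Lemma quad_form_ge a H m (v : 'M[C]_(m, n)) : herm H ->
  (forall i, a <= spectral_diag H 0 i) -> a * frob v v <= quad_form H v.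
Proof.
move=> hH ha; rewrite [in leRHS](herm_spectral hH) quad_form_conj_diag.
rewrite (frob_unitary _ (spectral_unitarymx H)) mulr_sumr.
apply: ler_sum => i _; apply: ler_wpM2r; last exact: ha.
by apply: sumr_ge0 => k _; rewrite exprn_ge0.
Qed.

Lemma quad_form_le a H m (v : 'M[C]_(m, n)) : herm H ->
  (forall i, spectral_diag H 0 i <= a) -> quad_form H v <= a * frob v v.
Proof.
move=> hH ha; rewrite [in leLHS](herm_spectral hH) quad_form_conj_diag.
rewrite (frob_unitary _ (spectral_unitarymx H)) mulr_sumr.
apply: ler_sum => i _; apply: ler_wpM2r; last exact: ha.
by apply: sumr_ge0 => k _; rewrite exprn_ge0.
Qed.

Lemma spectral_diag_le_trace H i : herm H ->
  (forall j, 0 <= spectral_diag H 0 j) -> spectral_diag H 0 i <= \tr H.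
Proof.
move=> hH d0; rewrite herm_trace_spectral // (bigD1 i) //= lerDl.
by apply: sumr_ge0 => j _.
Qed.

Lemma herm_posdef_spectral_gt0 H i : herm_posdef H -> 0 < spectral_diag H 0 i.
Proof.
by case=> hH pH; have [u0 ->] := herm_spectral_diagE i hH; apply: pH.
Qed.

Lemma herm_posdef_det_gt0 H : herm_posdef H -> 0 < \det H.
Proof.
move=> pH; rewrite herm_det_spectral; last by case: pH.
by apply: prodr_gt0 => i _; apply: herm_posdef_spectral_gt0.
Qed.

(** The eigenvalues of a density matrix lie in [0, 1], so each of them
    dominates their product, the determinant. *)
Lemma dens_pos_quad_form_ge H m (v : 'M[C]_(m, n)) : dens_pos H ->
  \det H * frob v v <= quad_form H v.
Proof.
move=> [pH tr1]; have hH : herm H by case: pH.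
have d0 j : 0 <= spectral_diag H 0 j by apply/ltW/herm_posdef_spectral_gt0.
have d1 j : spectral_diag H 0 j <= 1 by rewrite -tr1 spectral_diag_le_trace.
apply: quad_form_ge => // i; rewrite herm_det_spectral // (bigD1 i) //=.
rewrite ler_piMr //; apply: prodr_ile1 => j _; by rewrite d0 d1.
Qed.

(** The operator norm of [B] is at most its Frobenius norm: the eigenvalues of
    the Gram matrix are nonnegative, hence bounded by its trace. *)
Lemma gram_quad_form_le p m (B : 'M[C]_(n, p)) (v : 'M[C]_(m, n)) :
  frob (v *m B) (v *m B) <= \tr (B *m B ^t*) * frob v v.
Proof.
have hH : herm (B *m B ^t*) by apply/hermP; rewrite adjM trmxCK.
have -> : frob (v *m B) (v *m B) = quad_form (B *m B ^t*) v.
  by rewrite /frob /quad_form adjM -[in RHS]mulmxA -[in RHS]mulmxA [in RHS]mxtrace_mulC !mulmxA.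
apply: quad_form_le => // i; apply: spectral_diag_le_trace => // j.
have [_ ->] := herm_spectral_diagE j hH; set u := (row _ _) ^t*.
have -> : u ^t* *m (B *m B ^t*) *m u = (B ^t* *m u) ^t* *m (B ^t* *m u).
  by rewrite adjM trmxCK !mulmxA.
by have := frob_ge0 (B ^t* *m u); rewrite /frob /mxtrace big_ord1.
Qed.

End Spectral.

(** * Coercivity on the orthogonal complement of the kernel *)

Lemma orth_kernel_bound (C : numClosedFieldType) (p q : nat) (A : 'M[C]_(p, q)) :
  exists2 M : C, 0 < M & forall y : 'rV[C]_p,
    (forall z, z *m A = 0 -> frob y z = 0) ->
    frob y y <= M * frob (y *m A) (y *m A).
Proof.
pose B := pinvmx A; exists (1 + \tr (B *m B ^t*)).
  (* adding 1 keeps the constant positive when [A = 0] *)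
  rewrite ltr_wpDr ?ltr01 //.
  by have := frob_ge0 (B ^t*); rewrite /frob trmxCK.
move=> y oy; pose w := y *m A *m B.
(* [z] is the component of [y] in the kernel, so |w|^2 = |y|^2 + |z|^2 *)
have [z zE] : exists z, z = y - w by exists (y - w).
have zA : z *m A = 0.
  by rewrite zE mulmxBl /w mulmxKpV ?submxMl // subrr.
have yz : frob y z = 0 by apply: oy.
have zy : frob z y = 0 by rewrite frobC yz conjC0.
have wE : w = y - z by rewrite zE opprB addrC subrK.
apply: (@le_trans _ _ (frob w w)).
  by rewrite wE frobBl !frobBr yz zy subr0 sub0r opprK lerDl frob_ge0.
rewrite (le_trans (gram_quad_form_le _ _)) // ler_wpM2r ?frob_ge0 //.
by rewrite lerDr ler01.
Qed.

Section Gradient.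
Variables (C : numClosedFieldType) (n N : nat) (L : 'I_N -> 'M[C]_n).
Hypothesis hL : forall k, herm (L k).

Lemma grad_adj (Y : 'M[C]_n) : grad L Y = 0 -> grad L (Y ^t*) = 0.
Proof.
rewrite !grad_eq0 => h k; have := congr1 (fun Z : 'M[C]_n => Z ^t*) (h k).
by rewrite !adjM (hermP (L k)).1.
Qed.

(** The complex kernel of [grad L] is spanned by its Hermitian part, so
    orthogonality to the latter suffices. *)
Lemma orth_ker_grad (Y Z : 'M[C]_n) :
  (forall W, ker_grad L W -> hs_dot Y W = 0) ->
  grad L Z = 0 -> hs_dot Y Z = 0.
Proof.
move=> oY gZ; have gZ' := grad_adj gZ.
(* [Z + Z^*] and ['i (Z - Z^* )] are Hermitian elements of the kernel *)
have h1 : frob Y (Z + Z ^t*) = 0.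
  apply: oY; split; last by rewrite linearD /= gZ gZ' addr0.
  by apply/hermP; rewrite linearD /= map_mxD trmxCK addrC.
have h2 : frob Y ('i *: (Z - Z ^t*)) = 0.
  apply: oY; split; last by rewrite linearZ /= linearB /= gZ gZ' subrr scaler0.
  apply/hermP; rewrite linearZ /= map_mxZ adjB trmxCK [X in X *: _]conjCi.
  by rewrite scaleNr -scalerN opprB.
move: h2; rewrite frobZr => /eqP; rewrite mulf_eq0 (negPf (neq0Ci _)) /= => /eqP h2.
have : frob Y (Z + Z ^t*) + frob Y (Z - Z ^t*) = 0 by rewrite h1 h2 addr0.
rewrite -frobDr addrACA subrr addr0 frobDr -mulr2n => /eqP.
by rewrite mulrn_eq0 /= => /eqP.
Qed.

Lemma grad_coercive : exists2 M : C, 0 < M & forall Y : 'M[C]_n,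
  (forall W, ker_grad L W -> hs_dot Y W = 0) ->
  hs_dot Y Y <= M * frob (grad L Y) (grad L Y).
Proof.
have [M M0 hM] := orth_kernel_bound (lin_mx (grad L)).
exists M => // Y oY; have := hM (mxvec Y).
rewrite mul_vec_lin !frob_mxvec; apply=> z gz.
have -> : z = mxvec (vec_mx z) by rewrite vec_mxK.
rewrite frob_mxvec; apply: orth_ker_grad => //.
by move: gz; rewrite -[z in z *m _]vec_mxK mul_vec_lin => /eqP;
   rewrite mxvec_eq0 => /eqP.
Qed.

End Gradient.

(** * Continuity of the determinant and compactness *)

Lemma det_continuous (K : numFieldType) (n : nat) :
  continuous (fun A : 'M[K]_n => \det A).
Proof.
apply: continuous_big => [|s _]; first exact: (@add_continuous K^o).
move=> A; apply: (@cvgM _ _ (nbhs A)); first exact: cvg_cst.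
apply: cvg_big => [|i _]; first exact: mul_continuous.
exact: coord_continuous.
Qed.

(** A complex number that is positive in the partial order of the complex
    field is a positive real. *)
Lemma gt0_cplxE (R : realType) (z : cplx R) :
  0 < z -> z = cplx_of (complex.Re z) /\ 0 < complex.Re z.
Proof.
move=> z0; have zE : z = cplx_of (complex.Re z).
  by rewrite /cplx_of RRe_real // gtr0_real.
by split=> //; move: z0; rewrite [in X in X -> _]zE /cplx_of (@ltcR _ 0).
Qed.

(** This lets the extreme value theorem, which needs a real-valued function,
    be applied to the real part of the determinant. *)
Lemma complex_Re_continuous (R : realType) :
  continuous (fun z : cplx R => complex.Re z : R).
Proof.
move=> z B /= /(nbhs_ballP (complex.Re z)) [e e0 eB].
apply/nbhs_ballP; exists (cplx_of e) => [|w]; first by rewrite /= ltcR.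
rewrite /= => zw; apply: eB; change (`|complex.Re z - complex.Re w| < e).
rewrite -raddfB -ltcR; exact: le_lt_trans (normc_ge_Re _) zw.
Qed.

Lemma dens_pos_compact_det_ge (R : realType) (n : nat) (K : set 'M[cplx R]_n) :
  K `<=` dens_pos (C := cplx R) (n := n) -> compact K ->
  exists2 d : R, 0 < d & forall rho, K rho -> cplx_of d <= \det rho.
Proof.
move=> KD Kc; have [->|/set0P K0] := eqVneq K set0.
  by exists 1.
have detP rho : K rho -> 0 < \det rho.
  by move=> /KD [/herm_posdef_det_gt0].
have [|rho0 /set_mem K0' hmin] := @compact_EVT_min _ R
    (fun A : 'M[cplx R]_n => complex.Re (\det A)) K K0 Kc.
  apply: continuous_subspaceT => A.
  apply: continuous_comp; first exact: det_continuous.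
  exact: complex_Re_continuous.
exists (complex.Re (\det rho0)); first by have [] := gt0_cplxE (detP _ K0').
move=> rho Kr; have [-> _] := gt0_cplxE (detP _ Kr).
by rewrite lecR; apply: hmin; rewrite inE.
Qed.

Unset Implicit Arguments.

Theorem theorem3 (R : realType) (n N : nat) (hn : (1 <= n)%N) (hN : (1 <= N)%N)
    (L : 'I_N -> 'M[cplx R]_n) (hL : forall k, herm (L k))
    (K : set 'M[cplx R]_n) (KD : K `<=` dens_pos (C := cplx R) (n := n))
    (Kcompact : compact K) :
  exists c : R, 0 < c /\
    forall X rho : 'M[cplx R]_n, herm X -> K rho ->
      cplx_of c * hs_norm (X - proj_ker L X) ^+ 2
        <= quad_form rho (grad L (X - proj_ker L X)).
Proof.
have [d d0 hd] := dens_pos_compact_det_ge KD Kcompact.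
have [M M0 hM] := grad_coercive hL.
have [ME m0] := gt0_cplxE M0.
exists (d / complex.Re M); split; first exact: divr_gt0.
move=> X rho hX Kr.
have [_ oY] := proj_kerP hL hX; set Y := X - _ in oY *.
rewrite /hs_norm sqrtCK.
rewrite /cplx_of rmorphM fmorphV /= -/(cplx_of d) -/(cplx_of (complex.Re M)) -ME.
have d0' : 0 <= cplx_of d by rewrite lecR ltW.
apply: (@le_trans _ _ (cplx_of d * frob (grad L Y) (grad L Y))).
  by rewrite -mulrA ler_wpM2l // ler_pdivrMl // hM.
apply: (le_trans _ (dens_pos_quad_form_ge _ (KD _ Kr))).
by rewrite ler_wpM2r ?frob_ge0 ?hd.
Qed.
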